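(* Let $\mathcal{S}$ be a finite pool of mutually independent weighted Bernoulli random variables and let $k\le|\mathcal{S}|$. Run the greedy hill-climbing algorithm: start with $T_0=\emptyset$ and for $t=0,\dots,k-1$ set $T_{t+1}=T_t\cup\{Z\}$ where $Z\in\mathcal{S}\setminus T_t$ maximizes $\mathbb{E}(\max(T_t\cup\{Z\}))$. Then $T_k$ maximizes $\mathbb{E}(\max(T))$ over all $k$-element subsets $T\subseteq\mathcal{S}$.
   Context: A random variable $X$ is weighted Bernoulli if for some $x\ge0$ and $p\in[0,1]$, $X=x$ with probability $p$ and $X=0$ otherwise. For a set $T$ of random variables, $\max(T)$ denotes their pointwise maximum (and $\max(\emptyset)=0$). *)

(* Defs.v *)
From HB Require Import structures.
From mathcomp Require Import all_boot all_order all_algebra.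
From mathcomp Require Import all_classical all_reals all_analysis.

Set Implicit Arguments.
Unset Strict Implicit.
Unset Printing Implicit Defensive.

Import Order.TTheory GRing.Theory Num.Theory.

Local Open Scope classical_set_scope.
Local Open Scope ring_scope.

(* The law is p * delta_x + (1 - p) * delta_0.  Stating it through point masses
   (rather than P(X = x) = p and P(X = 0) = 1 - p) also covers x = 0. *)
Definition weighted_bernoulli (d : measure_display) (Om : measurableType d)
    (R : realType) (P : probability Om R) (X : {RV P >-> R}) : Prop :=
  exists x p : R, [/\ 0 <= x, 0 <= p <= 1 &
    forall A : set R, measurable A ->
      distribution P X A = (p%:E * \d_x A + (1 - p)%:E * \d_(0%R : R) A)%E].

Definition mutually_independent (d : measure_display) (Om : measurableType d)
    (R : realType) (P : probability Om R) (I : finType)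
    (X : I -> {RV P >-> R}) : Prop :=
  forall (J : {set I}) (A : I -> set R), (forall i, measurable (A i)) ->
    P (\bigcap_(i in [set` J]) (X i @^-1` A i)) =
    (\prod_(i in J) P (X i @^-1` A i))%E.

(* The fold starts from a member of the set, so that the default value 0 only
   enters when the set is empty. *)
Definition max_set (Om : Type) (R : realType) (I : finType)
    (X : I -> Om -> R) (T : {set I}) (w : Om) : R :=
  if [pick i in T] is Some i0
  then \big[Num.max/X i0 w]_(i in T) X i w
  else 0.

Definition Emax (d : measure_display) (Om : measurableType d)
    (R : realType) (P : probability Om R) (I : finType)
    (X : I -> {RV P >-> R}) (T : {set I}) : \bar R :=
  ('E_P[max_set (fun i => X i : Om -> R) T])%E.

(* A relation rather than a function: ties may be broken arbitrarily. *)
Definition greedy_run (d : measure_display) (Om : measurableType d)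
    (R : realType) (P : probability Om R) (I : finType)
    (X : I -> {RV P >-> R}) (k : nat) (T : nat -> {set I}) : Prop :=
  T 0%N = finset.set0 /\
  forall t : nat, (t < k)%N ->
    exists Z : I, [/\ Z \notin T t, T t.+1 = (Z |: T t)%SET &
      forall Z' : I, Z' \notin T t ->
        (Emax X (Z' |: T t)%SET <= Emax X (Z |: T t)%SET)%E].

(* Main.v *)
(* List the variables by decreasing value x.  By independence the mean F(T) of
   the maximum over T satisfies F({h} + T) = p_h x_h + (1 - p_h) F(T) when x_h
   dominates the values in T.  For y above all values, y - F is
   log-supermodular.  By induction on the list, every optimal m-subset T extends
   to an optimal (m+1)-subset: compare T with an (m+1)-subset U on the top
   variable h.  The only case not immediate from the induction hypothesis is h
   in T but not in U.  There T - h extends to optimal sets of sizes m and m + 1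
   of the tail, of means v_m and v_{m+1}; log-supermodularity gives
   (x_h - v_m)^2 <= (x_h - v_{m-1}) (x_h - v_{m+1}), and the optimality of T
   gives v_m <= p_h x_h + (1 - p_h) v_{m-1}; together these yield
   v_{m+1} <= p_h x_h + (1 - p_h) v_m.  A greedy step therefore preserves
   optimality, however ties are broken. *)
Require Import Defs.
From HB Require Import structures.
From mathcomp Require Import all_boot all_order all_algebra.
From mathcomp Require Import ring lra.
From mathcomp Require Import all_classical all_reals all_analysis measurable_realfun.

Set Implicit Arguments.
Unset Strict Implicit.
Unset Printing Implicit Defensive.

Import Order.TTheory GRing.Theory Num.Theory.

Local Open Scope classical_set_scope.
Local Open Scope ring_scope.

(** * Mean of the maximum as a recursion along the sorted list *)

Section MeanMax.
Variables (R : realFieldType) (I : finType) (p x : I -> R).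

(** For [s] sorted by decreasing [x], a nonzero head decides the maximum; otherwise the tail does.
    Members of [T] outside [s] are ignored, so [h] may stay in [T] in the recursive call. *)
Fixpoint mean_max (s : seq I) (T : {set I}) : R :=
  if s is h :: s' then
    if h \in T then p h * x h + (1 - p h) * mean_max s' T else mean_max s' T
  else 0.

Lemma eq_mean_max s (T U : {set I}) :
  {in s, T =i U} -> mean_max s T = mean_max s U.
Proof.
elim: s => //= h s IH TU; rewrite TU ?mem_head// IH// => i si.
by rewrite TU// inE si orbT.
Qed.

Lemma mean_maxU1 s (T : {set I}) i :
  i \notin s -> mean_max s (i |: T)%SET = mean_max s T.
Proof.
move=> si; apply: eq_mean_max => j sj; rewrite in_setU1.
by case: eqP => // ji; rewrite -ji sj in si.
Qed.

Lemma mean_maxD1 s (T : {set I}) i :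
  i \notin s -> mean_max s (T :\ i)%SET = mean_max s T.
Proof.
move=> si; apply: eq_mean_max => j sj; rewrite in_setD1.
by case: eqP => // ji; rewrite -ji sj in si.
Qed.

Hypotheses (p01 : forall i, 0 <= p i <= 1) (x0 : forall i, 0 <= x i).

Let geqx := [rel i j | x j <= x i].

Let geqx_trans : transitive geqx.
Proof. by move=> j i k /= ji kj; exact: le_trans kj ji. Qed.

Lemma mean_max_le s (T : {set I}) y :
  0 <= y -> all (fun i => x i <= y) s -> mean_max s T <= y.
Proof.
move=> y0; elim: s => //= h s IH /andP[hy /IH{}IH].
case: ifP => // _; have /andP[p0 p1] := p01 h; nra.
Qed.

(** An occurrence of [i] turns the mean [v] of the tail into [p i * x i + (1 - p i) * v], which is
    no smaller because sortedness gives [v <= x i]. *)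
Lemma mean_maxU1_ge s (T : {set I}) i :
  sorted geqx s -> mean_max s T <= mean_max s (i |: T)%SET.
Proof.
elim: s => //= h s IH; rewrite (path_sortedE geqx_trans) => /andP[hs /IH{}IH].
have /andP[p0 p1] := p01 h; rewrite in_setU1.
have := mean_max_le T (x0 h) hs.
by case: (h \in T); rewrite ?orbT ?orbF //=; case: (h == i) => //=; nra.
Qed.

(* Log-supermodularity of [y - mean_max s T].  For independent variables this
   quantity is the integral over [0, y] of the product of the distribution
   functions, so the inequality is an instance of Chebyshev's. *)
Lemma mean_max_submod s (T : {set I}) i j : i != j ->
  uniq s -> sorted geqx s ->
  mean_max s T + mean_max s (i |: (j |: T))%SET <=
    mean_max s (i |: T)%SET + mean_max s (j |: T)%SET /\
  forall y, 0 <= y -> all (fun k => x k <= y) s ->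
  (y - mean_max s (i |: T)%SET) * (y - mean_max s (j |: T)%SET) <=
  (y - mean_max s T) * (y - mean_max s (i |: (j |: T))%SET).
Proof.
move=> ij; elim: s => [|h s IH]; first by split=> //=; rewrite !addr0.
rewrite [uniq _]/= [sorted _ _]/= (path_sortedE geqx_trans).
move=> /andP[hs us] /andP[hx ss].
have {IH} [S L'] := IH us ss.
have L := L' _ (x0 h) hx.
have B W := mean_max_le W (x0 h) hx.
have M W k := mean_maxU1_ge W k ss.
have /andP[p0 p1] := p01 h.
have := M T i; have := M T j; have := M (j |: T)%SET i.
have := M (i |: T)%SET j; rewrite finset.setUCA.
have := B T; have := B (j |: T)%SET; have := B (i |: T)%SET.
have := B (i |: (j |: T))%SET.
rewrite /= !in_setU1.
case hT: (h \in T); rewrite ?orbT ?orbF.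
  move: S L.
  move: (mean_max s T) (mean_max s (i |: T)%SET) (mean_max s (j |: T)%SET)
    (mean_max s (i |: (j |: T))%SET) => a b c e.
  move=> S L *; split; first nra.
  move=> y y0 /andP[hy _].
  (* Each new [y - mean] is [(y - x h) + (1 - p h) * (x h - mean)], so the difference of the two
     sides is the sum of the terms in [L1] and [S1]. The additive inequality is carried through the
     induction for [S1]. *)
  have L1 : 0 <= (1 - p h) ^+ 2 * ((x h - a) * (x h - e) - (x h - b) * (x h - c)).
    by apply: mulr_ge0; [exact: sqr_ge0 | rewrite subr_ge0].
  have S1 : 0 <= (y - x h) * ((1 - p h) * (b + c - a - e)).
    by rewrite !mulr_ge0//; lra.
  nra.
(* When the head is [i], or [j] below, the difference of the two sides is exactly
   [(y - x h) * (p h * (b - a))], and [a <= b] by monotonicity. *)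
have [hi|hi] := eqVneq h i.
  subst i; rewrite (negPf ij) /= !(mean_maxU1 _ hs).
  move: (mean_max s T) (mean_max s (j |: T)%SET) => a b *; split; first nra.
  move=> y y0 /andP[hy _].
  have : 0 <= (y - x h) * (p h * (b - a)) by rewrite !mulr_ge0//; lra.
  nra.
have [hj|hj] := eqVneq h j.
  subst j; rewrite finset.setUCA /= !(mean_maxU1 _ hs).
  move: (mean_max s T) (mean_max s (i |: T)%SET) => a b *; split; first nra.
  move=> y y0 /andP[hy _].
  have : 0 <= (y - x h) * (p h * (b - a)) by rewrite !mulr_ge0//; lra.
  nra.
by move=> *; split=> // y y0 /andP[_ ys]; exact: L'.
Qed.

(** * Optimal subsets and their one-element extensions *)

Definition optimal s m (T : {set I}) :=
  [/\ {subset T <= s}, #|T| = m &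
    forall U : {set I}, {subset U <= s} -> #|U| = m ->
      mean_max s U <= mean_max s T].

Lemma exists_notin s (T : {set I}) :
  uniq s -> (#|T| < size s)%N -> exists2 j, j \in s & j \notin T.
Proof.
move=> us Ts; apply/hasP; apply: contraTT Ts => /hasPn H.
rewrite -leqNgt -(card_uniqP us); apply/subset_leq_card/fintype.subsetP => j.
by move=> /H; rewrite negbK.
Qed.

Lemma card_sub_seq s (T : {set I}) :
  uniq s -> {subset T <= s} -> (#|T| <= size s)%N.
Proof.
by move=> us Ts; rewrite -(card_uniqP us); exact/subset_leq_card/fintype.subsetP.
Qed.

(** The extension offered by the hypothesis may depend on [U]; the best [j] outside [T] is at least
    as good as all of them. *)
Lemma optimal_step s m (T : {set I}) : uniq s -> optimal s m T ->
  (m < size s)%N ->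
  (forall U : {set I}, {subset U <= s} -> #|U| = m.+1 ->
    exists j, [/\ j \in s, j \notin T & mean_max s U <= mean_max s (j |: T)%SET]) ->
  exists j, [/\ j \in s, j \notin T & optimal s m.+1 (j |: T)%SET].
Proof.
move=> us [Ts Tm opt] ms H.
have [j0 j0s j0T] : exists2 j, j \in s & j \notin T by apply: exists_notin; rewrite ?Tm.
pose Q j := (j \in s) && (j \notin T).
have Qj0 : Q j0 by rewrite /Q j0s.
case: (@arg_maxP _ _ _ j0 Q (fun j => mean_max s (j |: T)%SET) Qj0).
move=> j /andP[js jT] jmax; exists j; split=> //; split.
- by move=> i /setU1P[->//|]; exact: Ts.
- by rewrite cardsU1 jT Tm.
- move=> U Us Um; have [i [is_ iT /le_trans]] := H U Us Um; apply.
  by apply: jmax; rewrite /Q is_.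
Qed.

Lemma sub_behead h s (T : {set I}) :
  {subset T <= h :: s} -> h \notin T -> {subset T <= s}.
Proof.
move=> Ts hT i iT; have := Ts _ iT; rewrite inE => /orP[/eqP ih|//].
by rewrite -ih iT in hT.
Qed.

Lemma subD1_behead h s (T : {set I}) :
  {subset T <= h :: s} -> {subset (T :\ h)%SET <= s}.
Proof.
move=> Ts; apply: (@sub_behead h); last by rewrite !inE eqxx.
by move=> i /setD1P[_]; exact: Ts.
Qed.

Lemma optimal_behead h s m (T : {set I}) : h \notin s -> h \notin T ->
  optimal (h :: s) m T -> optimal s m T.
Proof.
move=> hs hT [Ts Tm opt]; split=> //; first exact: sub_behead Ts hT.
move=> U Us Um; have := opt U _ Um; rewrite /= (negPf hT).
rewrite (negPf (contra (@Us h) hs)); apply.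
by move=> i /Us; rewrite inE orbC => ->.
Qed.

(** [p h < 1] allows cancelling the factor [1 - p h]; at [p h = 1] the tail does not affect the
    mean, so its part of [T] could be arbitrary. *)
Lemma optimalD1 h s m (T : {set I}) : h \notin s -> h \in T -> p h < 1 ->
  optimal (h :: s) m.+1 T -> optimal s m (T :\ h)%SET.
Proof.
move=> hs hT p1 [Ts Tm opt]; split; first exact: subD1_behead.
  by move: Tm; rewrite (cardsD1 h) hT => -[].
move=> U Us Um; have hU : h \notin U by apply: contra hs; exact: Us.
have := opt (h |: U)%SET; rewrite /= hT setU11 mean_maxU1// mean_maxD1//.
rewrite lerD2l ler_pM2l ?subr_gt0//; apply; last by rewrite cardsU1 hU Um.
by move=> i /setU1P[->|/Us]; rewrite inE ?eqxx// orbC => ->.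
Qed.

Lemma optimal_extend s m (T U : {set I}) : uniq s -> sorted geqx s ->
  optimal s m T -> {subset U <= s} -> #|U| = m.+1 ->
  exists j, [/\ j \in s, j \notin T &
    mean_max s U <= mean_max s (j |: T)%SET].
Proof.
elim: s m T U => [|h s IH] m T U.
  move=> _ _ _ Us Um; suff : U = finset.set0 by move=> U0; rewrite U0 cards0 in Um.
  by apply/setP => i; rewrite finset.in_set0; apply/negP => /Us.
move=> /[dup] uhs; rewrite [uniq _]/= [sorted _ _]/= (path_sortedE geqx_trans).
move=> /andP[hs us] /andP[hx ss] Topt Us Um.
(* The hypothesis is upgraded to yield a single optimal extension, so that extensions can be
   chained. *)
have {}IH m' T' : optimal s m' T' -> (m' < size s)%N ->
    exists j, [/\ j \in s, j \notin T' & optimal s m'.+1 (j |: T')%SET].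
  move=> T'opt m's; apply: optimal_step => // U' U's U'm; exact: IH U's U'm.
have [Ts Tm opt] := Topt.
have ms := card_sub_seq uhs Us; rewrite Um /= ltnS in ms.
have /andP[p0 p1] := p01 h.
have [hT|hT] := boolP (h \in T); last first.
  have Topt' := optimal_behead hs hT Topt.
  have [hU|hU] := boolP (h \in U).
    (* Extending by [h] itself leaves a comparison of [T] with [U :\ h], of equal size, in the
       tail. *)
    exists h; split=> //; first exact: mem_head.
    rewrite /= hU setU11 mean_maxU1// lerD2l ler_wpM2l ?subr_ge0//.
    rewrite -(mean_maxD1 U hs); case: Topt' => _ _; apply; first exact: subD1_behead.
    by move: Um; rewrite (cardsD1 h) hU => -[].
  have Us' := sub_behead Us hU.
  have [|j [js jT [_ _ jopt]]] := IH _ _ Topt'.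
    by rewrite -Um; exact: card_sub_seq.
  exists j; split=> //; first by rewrite inE js orbT.
  rewrite /= in_setU1 (negPf hU) (negPf hT) orbF.
  have /negPf -> : h != j by apply: contraNneq hs => ->.
  exact: jopt.
(* If [p h = 1], every set containing [h] has mean [x h], the largest possible, so any new [j]
   works. *)
move: p1; rewrite le_eqVlt => /orP[/eqP p1|p1].
  have [|j js jT] := @exists_notin (h :: s) T uhs; first by rewrite Tm ltnS.
  exists j; split=> //=; rewrite in_setU1 hT orbT p1 subrr !mul0r mul1r !addr0.
  by case: ifP => // _; exact: mean_max_le.
case: m => [|m] in Topt Tm Um ms opt *.
  by move: Tm => /eqP; rewrite cards_eq0 => /eqP T0; rewrite T0 inE in hT.
have Topt' := optimalD1 hs hT p1 Topt.
have [//|j [js jT jopt]] := IH _ _ Topt'.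
have hj : h != j by apply: contraNneq hs => ->.
exists j; split; first by rewrite inE js orbT.
  by apply: contra jT => jT; rewrite in_setD1 eq_sym hj.
have jE : mean_max s (j |: T)%SET = mean_max s (j |: (T :\ h))%SET.
  apply: eq_mean_max => i si; rewrite !inE.
  by have -> : i != h by apply: contraNneq hs => <-.
rewrite /= in_setU1 hT orbT jE.
have jopt' := jopt; have [_ jm {}jopt] := jopt'.
have [hU|hU] := boolP (h \in U).
  rewrite lerD2l ler_wpM2l ?subr_ge0 ?(ltW p1)// -(mean_maxD1 U hs).
  apply: jopt; first exact: subD1_behead.
  by move: Um; rewrite (cardsD1 h) hU => -[].
have Us' := sub_behead Us hU.
have [|i [is_ ij iopt]] := IH _ _ jopt'.
  by rewrite -Um; exact: card_sub_seq.
have [_ _ {}iopt] := iopt; have {}iopt := iopt _ Us' Um.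
have iNj : i != j by move: ij; rewrite in_setU1 negb_or => /andP[].
have [_ L] := mean_max_submod (T :\ h)%SET iNj us ss.
have {}L := L _ (x0 h) hx.
have iT : i \notin (T :\ h)%SET by move: ij; rewrite in_setU1 negb_or => /andP[].
have Li := mean_max_le (i |: (j |: (T :\ h)))%SET (x0 h) hx.
have Lj := mean_max_le (j |: (T :\ h))%SET (x0 h) hx.
have Mj := mean_maxU1_ge (T :\ h)%SET j ss.
have ji : mean_max s (i |: (T :\ h))%SET <= mean_max s (j |: (T :\ h))%SET.
  apply: jopt.
    by move=> k /setU1P[->//|]; exact: subD1_behead.
  by rewrite cardsU1 iT; case: Topt' => _ ->.
(* Optimality of [T] against the set of the same size that trades [h] for [j]. *)
have Th : mean_max s (j |: (T :\ h))%SET <=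
    p h * x h + (1 - p h) * mean_max s (T :\ h)%SET.
  have := opt (j |: (T :\ h))%SET; rewrite /= hT in_setU1 (negPf hj) in_setD1 eqxx /=.
  rewrite (mean_maxD1 T hs); apply=> //.
  by move=> k /setU1P[->|/setD1P[_ /Ts]//]; rewrite inE js orbT.
apply: le_trans iopt _.
move: L Li Lj Mj ji Th; clear -p0 p1.
(* [v0], [v1], [v2] are the optimal means in the tail for three consecutive sizes, and [y] is
   [x h]. *)
move: (mean_max s (T :\ h)%SET) (mean_max s (i |: (T :\ h))%SET)
  (mean_max s (j |: (T :\ h))%SET)
  (mean_max s (i |: (j |: (T :\ h)))%SET) (x h) (p h) p0 p1.
move=> v0 v1' v1 v2 y q q0 q1 L v2y v1y v01 v11 qv.
have L1 : (y - v1) ^+ 2 <= (y - v0) * (y - v2) by nra.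
(* The argument divides by [y - v0]. If this vanishes, [v0 <= v1 <= y] forces [v1 = y], and
   [v2 <= y] suffices. *)
have [v0y|v0y] := eqVneq v0 y; first by nra.
have a0 : 0 < y - v0 by rewrite subr_gt0 lt_neqAle v0y; lra.
suff : (1 - q) * (y - v1) <= y - v2 by lra.
rewrite -(ler_pM2l a0); apply: le_trans L1; rewrite expr2 mulrA.
by rewrite ler_wpM2r//; lra.
Qed.

Lemma optimal_superset s m (T : {set I}) : uniq s -> sorted geqx s ->
  (m < size s)%N -> optimal s m T ->
  exists j, [/\ j \in s, j \notin T & optimal s m.+1 (j |: T)%SET].
Proof.
move=> us ss ms Topt; apply: optimal_step => // U Us Um.
exact: optimal_extend Us Um.
Qed.
End MeanMax.

(** * Pointwise maximum as the first nonzero variable of the list *)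

Section MaxSet.
Variables (Om : Type) (R : realType) (I : finType) (X : I -> Om -> R).

Lemma max_set_eq (T : {set I}) (w : Om) (m : R) :
  (forall i, i \in T -> X i w <= m) ->
  (T = finset.set0 /\ m = 0) \/ (exists2 i, i \in T & X i w = m) ->
  max_set X T w = m.
Proof.
rewrite /max_set => ub; case: pickP => [i0 i0T|T0]; last first.
  by case=> [[_ ->]//|[i]]; rewrite T0.
case=> [[T0 _]|[i iT Xi]]; first by rewrite T0 finset.in_set0 in i0T.
apply/le_anti/andP; split.
  by apply: bigmax_le => [|j jT]; apply: ub.
by rewrite -Xi; exact: le_bigmax_cond.
Qed.

(* The value at [w] of the maximum over [T] of variables of which the one of
   index [i] takes only the values [0] and [x i], when [s] lists the indices
   by decreasing [x]. *)
Fixpoint first_hit (x : I -> R) (s : seq I) (T : {set I}) (w : Om) : R :=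
  if s is h :: s' then
    if (h \in T) && (X h w != 0) then x h else first_hit x s' T w
  else 0.

Variable x : I -> R.
Hypothesis x0 : forall i, 0 <= x i.

Lemma first_hit_ge0 s T w : 0 <= first_hit x s T w.
Proof. by elim: s => //= h s IH; case: ifP. Qed.

(** The first nonzero member of [T] in the list has the largest value, later ones having smaller
    [x]; if all members vanish, both sides are 0. *)
Lemma max_set_first_hit s (T : {set I}) w : sorted [rel i j | x j <= x i] s ->
  {subset T <= s} -> (forall i, X i w != 0 -> X i w = x i) ->
  max_set X T w = first_hit x s T w.
Proof.
move=> ss Ts Xx; apply: max_set_eq.
  move=> i iT; have [->|/[dup] Xi /Xx ->] := eqVneq (X i w) 0.
    exact: first_hit_ge0.
  move: (Ts _ iT) ss; elim: s {Ts} => // h s IH; rewrite inE /=.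
  rewrite (path_sortedE (leT := [rel i j | x j <= x i])); last first.
    by move=> j k l /= ji kj; exact: le_trans kj ji.
  move=> + /andP[hx ss] => /orP[/eqP <-|si]; first by rewrite iT Xi.
  by case: ifP => _; [exact: (allP hx)|exact: IH].
have [T0|[i iT]] := set_0Vmem T.
  left; split=> //; rewrite T0; elim: s {ss Ts} => //= h s ->.
  by rewrite finset.in_set0.
right; have [/existsP[j /andP[jT Xj]]|/existsPn none] :=
    boolP [exists j, (j \in T) && (X j w != 0)]; last first.
  exists i => //; have := none i; rewrite iT negbK => /eqP ->.
  elim: s {ss Ts} => //= h s <-; case: ifP => // H.
  by have := none h; rewrite H.
have := Ts _ jT; elim: s {ss Ts} => //= h s IH; rewrite inE.
case: ifPn => [/andP[hT Xh] _|H /orP[/eqP jh|/IH//]]; first by exists h => //; exact: Xx.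
by rewrite -jh jT Xj in H.
Qed.
End MaxSet.

(** * Expectation of the maximum under independence *)

Section Expectation.
Context (d : measure_display) (Om : measurableType d) (R : realType).

Lemma measurable_max_set (I : finType) (X : I -> Om -> R) (T : {set I}) :
  (forall i, measurable_fun setT (X i)) -> measurable_fun setT (max_set X T).
Proof.
move=> mX; rewrite /max_set; case: pickP => [i0 _|_]; last exact: measurable_cst.
elim: (index_enum I) => [|h r IH]; first by under eq_fun do rewrite big_nil; exact: mX.
under eq_fun do rewrite big_cons.
by case: (h \in T) => //; exact: measurable_maxr.
Qed.

Lemma measurable_first_hit (I : finType) (X : I -> Om -> R) x s (T : {set I}) :
  (forall i, measurable_fun setT (X i)) -> measurable_fun setT (first_hit X x s T).
Proof.
move=> mX; elim: s => [|h s IH] /=; first exact: measurable_cst.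
case: (h \in T) => //=; apply: measurable_fun_ifT => //.
by apply: measurable_neg; exact: measurable_fun_eqr.
Qed.


Variable P : probability Om R.

Lemma weighted_bernoulli_ae (X : {RV P >-> R}) : weighted_bernoulli X ->
  exists x : R, 0 <= x /\ {ae P, forall w, X w != 0 -> X w = x}.
Proof.
move=> [x [p [x0 _ HX]]]; exists x; split=> //.
pose A : set R := ~` [set 0; x].
have mA : measurable A by apply: measurableC; exact: measurableU.
exists (X @^-1` A); split.
- by rewrite -[X in measurable X]setTI; exact: measurable_funP.
- have := HX A mA; rewrite /distribution /pushforward => ->.
  by rewrite !diracE !memNset ?mule0 ?adde0// => -[]; [left|right].
- move=> w /= /not_implyP[/eqP X0 Xx]; rewrite /A /=.
  by case.
Qed.

Variables (I : finType) (X : I -> {RV P >-> R}).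
Hypothesis indep : mutually_independent X.

(** The Bernoulli weight when [x i > 0]; it is read off [P] because the law does not determine the
    weight when [x i = 0]. *)
Definition prob_nonzero i := fine (P (X i @^-1` [set~ 0])).

Local Notation pnz := prob_nonzero.

Let mXpre i (A : set R) : measurable A -> measurable (X i @^-1` A).
Proof. exact: measurable_funPTI. Qed.

Let mN0 : measurable ([set~ 0] : set R).
Proof. exact: measurableC. Qed.

Let PnzE i : P (X i @^-1` [set~ 0]) = (pnz i)%:E.
Proof. by rewrite /pnz fineK// fin_num_measure//; exact: mXpre. Qed.

Let PzE i : P (X i @^-1` [set 0]) = (1 - pnz i)%:E.
Proof.
have -> : X i @^-1` [set 0] = ~` (X i @^-1` [set~ 0]).
  by apply/seteqP; split=> w /=; [move=> -> /(_ erefl)|exact: contrapT].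
by rewrite probability_setC ?PnzE//; exact: mXpre.
Qed.

Lemma prob_nonzero01 i : 0 <= pnz i <= 1.
Proof.
rewrite fine_ge0//= -lee_fin -PnzE.
by apply: probability_le1; exact: mXpre.
Qed.

Let zero_on (J : {set I}) := \bigcap_(i in [set` J]) (X i @^-1` [set 0]).

Let measurable_zero_on J : measurable (zero_on J).
Proof.
by apply: fin_bigcap_measurable => // i _; exact: mXpre.
Qed.

Let zero_onU1 h J : zero_on (h |: J)%SET = zero_on J `&` (X h @^-1` [set 0]).
Proof.
apply/seteqP; split=> [w H|w [H Hh]].
  split; first by move=> i iJ; apply: H => /=; rewrite in_setU1 iJ orbT.
  by apply: H => /=; rewrite setU11.
by move=> i /= /setU1P[->//|]; exact: H.
Qed.

Let P_zero_onI h (J : {set I}) : h \notin J ->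
  P (zero_on J `&` (X h @^-1` [set~ 0])) =
  (pnz h * \prod_(i in J) (1 - pnz i))%:E.
Proof.
(* This choice of sets makes the event one intersection over [h |: J], to which independence
   applies. *)
move=> hJ; pose A i : set R := if i == h then [set~ 0] else [set 0].
have AJ i : i \in J -> A i = [set 0].
  by rewrite /A; case: eqP => // ->; rewrite (negPf hJ).
have Ah : A h = [set~ 0] by rewrite /A eqxx.
have -> : zero_on J `&` (X h @^-1` [set~ 0]) =
    \bigcap_(i in [set` (h |: J)%SET]) (X i @^-1` A i).
  apply/seteqP; split=> [w [H Hh] i /= /setU1P[->|iJ]|w H].
  - by rewrite Ah.
  - by rewrite AJ//; exact: H.
  - split; last by rewrite -Ah; apply: H => /=; rewrite setU11.
    move=> i /= iJ; have := H i; rewrite (AJ i)//=; apply.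
    by rewrite in_setU1 iJ orbT.
rewrite indep; last by move=> i; rewrite /A; case: ifP.
rewrite big_setU1//= Ah PnzE EFinM -prodEFin; congr (_ * _)%E.
by apply: eq_bigr => i iJ; rewrite AJ// PzE.
Qed.

(** [J] collects the variables already seen to vanish. Splitting [zero_on J] by whether [X h]
    vanishes gives [A], where the integrand is [x h], and [B], where the induction hypothesis
    applies to [h |: J]. *)
Lemma integral_first_hit x s (T J : {set I}) : (forall i, 0 <= x i) ->
  uniq s -> {in s, forall i, i \notin J} ->
  (\int[P]_(w in zero_on J) (first_hit (fun i => X i : Om -> R) x s T w)%:E =
   (\prod_(i in J) (1 - pnz i) * mean_max pnz x s T)%:E)%E.
Proof.
move=> x0; elim: s J => [|h s IH] J /=.
  by rewrite mulr0 integral0.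
move=> /andP[hs us] sJ.
have {}IH J' := IH J' us.
have hJ : h \notin J by apply: sJ; exact: mem_head.
have sJ' : {in s, forall i, i \notin J}.
  by move=> i si; apply: sJ; rewrite inE si orbT.
have [hT|hT] := boolP (h \in T); last by rewrite /= IH.
pose A := zero_on J `&` (X h @^-1` [set~ 0]).
pose B := zero_on (h |: J)%SET.
have mA : measurable A by apply: measurableI => //; exact: mXpre.
have mB : measurable B by exact: measurable_zero_on.
have AB : zero_on J = A `|` B.
  rewrite /A /B zero_onU1 -setIUr -preimage_setU setUC setUv.
  by rewrite preimage_setT setIT.
rewrite AB ge0_integral_setU//=; last 3 first.
- apply/measurable_funTS/measurable_EFinP.
  have := measurable_first_hit x (h :: s) T (fun i => measurable_funPT (X i)).
  by rewrite /= hT.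
- move=> w _; rewrite lee_fin.
  by have := first_hit_ge0 X x0 (h :: s) T w; rewrite /= hT.
- apply/disj_setPS => w [[_ /= X0]]; rewrite /B zero_onU1 => -[_]; exact: X0.
rewrite (@eq_integral _ _ _ P A (cst (x h)%:E)); last first.
  by move=> w /set_mem[_ /= /eqP ->].
rewrite (@eq_integral _ _ _ P B
    (fun w => (first_hit (fun i => X i : Om -> R) x s T w)%:E)); last first.
  by move=> w /set_mem; rewrite /B zero_onU1 => -[_ /= ->]; rewrite eqxx.
rewrite integral_cst// [X in (_ * X + _)%E](P_zero_onI hJ) IH; last first.
  move=> i si; rewrite in_setU1 negb_or sJ' // andbT.
  by apply: contraNneq hs => <-.
rewrite -EFinM -EFinD big_setU1//=; congr EFin; ring.
Qed.

Lemma Emax_mean_max x s (T : {set I}) : (forall i, 0 <= x i) ->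
  (forall i, {ae P, forall w, X i w != 0 -> X i w = x i}) ->
  uniq s -> sorted [rel i j | x j <= x i] s -> {subset T <= s} ->
  Emax X T = (mean_max pnz x s T)%:E.
Proof.
move=> x0 Xx us ss Ts; rewrite /Emax unlock.
have mX i : measurable_fun setT (X i : Om -> R) by exact: measurable_funPT.
rewrite (@ae_eq_integral _ _ _ P setT
  (fun w => (first_hit (fun i => X i : Om -> R) x s T w)%:E))//.
(* With [J] empty, [zero_on J] is the whole space and the product is 1. *)
- have := @integral_first_hit x s T finset.set0 x0 us.
  rewrite big_set0 mul1r => <-; last by move=> i _; rewrite finset.in_set0.
  congr (integral _ _ _); apply/esym/seteqP; split=> // w _ i /=.
  by rewrite finset.in_set0.
- by apply/measurable_EFinP; exact: measurable_max_set.
- by apply/measurable_EFinP; exact: measurable_first_hit.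
have : \forall w \ae P, forall i, X i w != 0 -> X i w = x i.
  exact: filter_forall.
apply: filterS => w Hw _; congr EFin; exact: max_set_first_hit.
Qed.

End Expectation.

Theorem theorem4p3 (d : measure_display) (Om : measurableType d)
    (R : realType) (P : probability Om R) (I : finType)
    (X : I -> {RV P >-> R})
    (hbern : forall i : I, weighted_bernoulli (X i))
    (hindep : mutually_independent X)
    (k : nat) (hk : (k <= #|I|)%N)
    (T : nat -> {set I}) (hT : greedy_run X k T) :
  #|T k| = k /\
  forall U : {set I}, #|U| = k -> (Emax X U <= Emax X (T k))%E.
Proof.
have [x /all_and2[x0 Xx]] := choice (fun i => weighted_bernoulli_ae (hbern i)).
pose le_x := [rel i j | x j <= x i].
pose s := sort le_x (enum I).
have le_x_total : total le_x by move=> i j; exact: le_total.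
have ss : sorted le_x s by exact: sort_sorted.
have us : uniq s by rewrite sort_uniq enum_uniq.
have sI i : i \in s by rewrite mem_sort mem_enum.
have size_s : size s = #|I| by rewrite size_sort -cardE.
have EmaxE (U : {set I}) : Emax X U = (mean_max (prob_nonzero X) x s U)%:E.
  by apply: Emax_mean_max.
(* The invariant is optimality of every stage among sets of its own size. *)
suff H t : (t <= k)%N -> optimal (prob_nonzero X) x s t (T t).
  have [_ Tk opt] := H k (leqnn k).
  by split=> // U Uk; rewrite !EmaxE lee_fin; exact: opt.
case: hT => T0 Tstep; elim: t => [_|t IH tk].
  rewrite T0; split=> [i||U _ /eqP]; rewrite ?finset.in_set0 ?cards0//.
  by rewrite cards_eq0 => /eqP ->.
have [Z [ZT -> Zmax]] := Tstep t tk.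
have Topt := IH (ltnW tk).
have ts : (t < size s)%N by rewrite size_s (leq_trans tk).
have [j [_ jT [_ _ jopt]]] :=
  optimal_superset (prob_nonzero01 X) x0 us ss ts Topt.
split=> // [|U Us Ut]; first by rewrite cardsU1 ZT; case: Topt => _ ->.
(* [Z] does at least as well as the optimal extension by [j], hence is optimal whichever way ties
   are broken. *)
by apply: le_trans (jopt U Us Ut) _; rewrite -lee_fin -!EmaxE; exact: Zmax.
Qed.
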